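(* Let $G$ be an infinite, countable, discrete, abelian, residually finite group, let $(\Gamma_n)_{n\in\mathbb{N}}$ be a decreasing sequence of finite index subgroups of $G$ with $\bigcap_{n\in\mathbb{N}}\Gamma_n=\{0\}$, and let $(D_n)_{n\in\mathbb{N}}$ be a sequence of subsets of $G$ such that for all $n\in\mathbb{N}$: (i) $G=\bigcup_{m\in\mathbb{N}}D_m$; (ii) $0\in D_n\subseteq D_{n+1}$; (iii) $D_n$ is a fundamental domain of $G/\Gamma_n$; (iv) $D_l=\bigcup_{\gamma\in D_l\cap\Gamma_n}(\gamma+D_n)$ for all $l>n$; (v) $(D_m)_{m\in\mathbb{N}}$ is a Følner sequence in $G$. Let $\Sigma$ be a finite alphabet and let $x\in\Sigma^G$ be an array such that $(\overline{O_G}(x),G)$ is minimal. If for every $t\in\mathbb{N}$ and every $B\in W_{D_t}(x)$ there exists a real number $\nu(B)$ such that $\mathrm{ap}(B,C)$ converges to $\nu(B)$ uniformly in $C\in W_{D_s}(x)$ as $s\to\infty$, then the subshift $(\overline{O_G}(x),G)$ is strictly ergodic.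
   Context: $\mathbb{N}=\{1,2,\dots\}$. A group $G$ (countable, discrete, abelian) is residually finite if there is a decreasing sequence of finite index subgroups with trivial intersection. $\Sigma^G$ carries the product topology and the shift action $(gx)(h)=x(h+g)$; $\overline{O_G}(x)$ is the closure of $\{gx:g\in G\}$. A system is minimal if every orbit is dense, and strictly ergodic if it is minimal and admits exactly one $G$-invariant Borel probability measure. A fundamental domain of $G/\Gamma$ is a set $D\subseteq G$ containing exactly one representative of each coset. A Følner sequence is a sequence of finite sets $F_n\subseteq G$ with $\#[(g+F_n)\triangle F_n]/\#F_n\to0$ for every $g\in G$. $W_{D_t}(x)$ is the set of $D_t$-symbols of $x$: blocks $B:D_t\to\Sigma$ for which there exists $\gamma\in\Gamma_t$ with $B(d)=x(d+\gamma)$ for all $d\in D_t$. For $s\ge t$, $B\in W_{D_t}(x)$, $C\in W_{D_s}(x)$, set $$\mathrm{ap}(B,C)=\frac{1}{\#(D_s\cap\Gamma_t)}\cdot\#\{\gamma\in D_s\cap\Gamma_t : \forall d\in D_t:\ C(d+\gamma)=B(d)\}.$$ ''$\mathrm{ap}(B,C)$ converges to $\nu(B)$ uniformly in $C\in W_{D_s}(x)$ as $s\to\infty$'' means: for every $\varepsilon>0$ there exists $s_0\in\mathbb{N}$ such that $|\mathrm{ap}(B,C)-\nu(B)|<\varepsilon$ for all $s\ge s_0$ and all $C\in W_{D_s}(x)$. *)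

(* Defs.v *)
From HB Require Import structures.
From mathcomp Require Import all_boot all_order all_algebra finmap.
From mathcomp Require Import all_classical all_reals all_analysis.

Set Implicit Arguments.
Unset Strict Implicit.
Unset Printing Implicit Defensive.

Import Order.TTheory GRing.Theory Num.Theory.
Import numFieldNormedType.Exports.

Local Open Scope classical_set_scope.
Local Open Scope ring_scope.

Section Groups.
Variable G : zmodType.
Implicit Types (g : G) (H D A : set G).

Definition translate g A : set G := [set g + a | a in A].

Definition subgroup H : Prop := zmod_closed (mem H).

Definition finite_index H : Prop :=
  finite_set [set translate g H | g in [set: G]].

Definition residually_finite : Prop :=
  exists H : nat -> set G,
    [/\ forall n, subgroup (H n),
        forall n, finite_index (H n),
        forall n, H n.+1 `<=` H n
      & \bigcap_n H n = [set 0]].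

Definition fundamental_domain H D : Prop :=
  forall g, exists! d, (D `&` translate g H) d.

(* Only used for finite sets: [fset_set A] is empty when [A] is infinite. *)
Definition ncard A : nat := (#|` fset_set A|)%fset.

Definition folner (R : realType) (F : nat -> set G) : Prop :=
  [/\ forall n, finite_set (F n),
      forall n, F n !=set0
    & forall g, (fun n => (ncard (translate g (F n) `+` F n))%:R
                          / (ncard (F n))%:R : R) @ \oo --> (0 : R)].

End Groups.

Definition borel (X : ptopologicalType) := g_sigma_algebraType (@open X).

Section Systems.
Variables (G : zmodType) (X : ptopologicalType) (act : G -> X -> X).

Definition minimal_system : Prop :=
  forall y : X, dense [set act g y | g in [set: G]].

Definition invariant_measure (R : realType) (mu : probability (borel X) R) :=
  forall (g : G) (A : set (borel X)), measurable A ->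
    mu (act g @^-1` A) = mu A.

(* Uniqueness means agreement on Borel sets: a measure is a total function on
   [set X] whose values outside the sigma-algebra are irrelevant. *)
Definition uniquely_ergodic (R : realType) : Prop :=
  exists mu : probability (borel X) R, invariant_measure mu /\
    forall nu : probability (borel X) R, invariant_measure nu ->
      forall A : set (borel X), measurable A -> nu A = mu A.

Definition strictly_ergodic (R : realType) : Prop :=
  minimal_system /\ uniquely_ergodic R.

End Systems.

Section Subshifts.
Variables (G : zmodType) (S : finType).

Definition full_shift : topologicalType :=
  prod_topology (fun _ : G => discrete_topology S).

Definition shift (g : G) (x : full_shift) : full_shift := fun h => x (h + g).

Definition orbit_closure (x : full_shift) : set full_shift :=
  closure [set shift g x | g in [set: G]].

Lemma shift0 x : shift 0 x = x.
Proof. by apply/funext => h; rewrite /shift addr0. Qed.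

Lemma shiftD g h x : shift (g + h) x = shift g (shift h x).
Proof. by apply/funext => k; rewrite /shift addrA. Qed.

Lemma shift_continuous g : continuous (shift g).
Proof.
move=> x.
have FF : Filter (nbhs x) by exact: nbhs_filter.
have gFF : Filter (shift g @ x) by exact: fmap_filter.
apply/(@cvg_sup _ _ _ (shift g @ x) _ gFF) => h U [V [[W oW WV] Vx] VU].
rewrite -WV in Vx VU.
have xW : nbhs (x (h + g)) W by apply: open_nbhs_nbhs; split.
have xW' := @proj_continuous G (fun=> discrete_topology S) (h + g) x W xW.
by apply: (@filterS _ _ FF _ _ _ xW') => y Wy; exact: VU.
Qed.

Lemma orbit_closure_shift x g y :
  orbit_closure x y -> orbit_closure x (shift g y).
Proof.
move=> xy U /shift_continuous /xy [_ [[h _ <-] Uh]].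
by exists (shift (g + h) x); split; [exists (g + h)|rewrite shiftD].
Qed.

Lemma orbit_closure_refl x : orbit_closure x x.
Proof. by apply: subset_closure; exists 0 => //; exact: shift0. Qed.

(* A subset coerces to its type of elements, with the induced topology. *)
Definition subshift (x : full_shift) : Type := orbit_closure x.

HB.instance Definition _ x := Topological.on (subshift x).
HB.instance Definition _ x :=
  isPointed.Build (subshift x) (SigSub (mem_set (@orbit_closure_refl x))).

Definition subshift_act x (g : G) (y : subshift x) : subshift x :=
  SigSub (mem_set (@orbit_closure_shift x g _ (set_mem (valP y)))).

End Subshifts.

Section Arrays.
Variables (G : zmodType) (S : finType).
Variables (Gamma D : nat -> set G) (x : full_shift G S).

Definition block (A : set G) : Type := A -> S.

Definition symbols (t : nat) : set (block (D t)) :=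
  [set B | exists2 g, Gamma t g & forall d : D t, B d = x (val d + g)].

(* The equation C (d + g) = B d includes that d + g lies in the domain of C. *)
Definition occurrences (t s : nat) (B : block (D t)) (C : block (D s)) :=
  [set g | (D s `&` Gamma t) g /\
    forall d : D t, exists2 e : D s, val e = val d + g & C e = B d].

Definition ap (R : realType) (t s : nat) (B : block (D t)) (C : block (D s)) : R
  := (ncard (occurrences B C))%:R / (ncard (D s `&` Gamma t))%:R.

Definition ap_converges_uniformly (R : realType) (t : nat) (B : block (D t))
    (nu : R) : Prop :=
  forall eps : R, 0 < eps -> exists s0 : nat, forall s : nat,
    (t <= s)%N -> (s0 <= s)%N -> forall C : block (D s), symbols C ->
      `|ap R B C - nu| < eps.

End Arrays.

(* Main.v *)
From HB Require Import structures.
Require Import Defs.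
From mathcomp Require Import all_boot all_order all_algebra finmap.
From mathcomp Require Import all_classical all_reals all_analysis.
From mathcomp Require Import measurable_realfun ring lra.

(** Minimality is part of the hypotheses, so the content of the theorem is that
    the subshift carries exactly one invariant probability measure.  The reason
    is that ergodic averages converge uniformly.  For a cylinder [U], call the
    averages of its indicator along [D n] started at a point [y] the averages
    of [U] at [y]; they are shown to converge, uniformly in [y], to a number
    that depends on [U] alone, the frequency of [U].

    The hypothesis on [ap] only controls the positions in [Gamma t] inside a
    translate of [D s] by an element of [Gamma s], so uniform convergence is
    reached in two steps.

    - Aligned windows ([aligned_sum_near_constant]).  Cut [z + D s], for [z] in
      [Gamma s], into translates of a smaller tile [D t].  Except near the
      boundary of such a translate, which is a small part of it by the Folner
      property, the indicator is determined by the symbol of [x] seen there.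
      Hence the average over [z + D s] is almost a linear combination of the
      numbers [ap B C], with coefficients that do not depend on [z], and these
      numbers are almost constant in [C] when [s] is large.

    - Arbitrary windows ([unaligned_sum_le]).  A translate [D n + g] is not a
      union of aligned tiles, but it differs from the union of the tiles
      [z + D s] with [z] in [Gamma s] and in [D n + g] by a part of small
      relative size, again by the Folner property.  So every average over a
      translate of [D n] is almost the same constant ([uniform_frequency]).

    Every point of the subshift agrees on any finite window with a point of the
    orbit of [x], which turns uniformity along the orbit into uniformity on the
    whole space ([average_near_constant]).  Integrating the averages against an
    invariant probability measure shows that it gives [U] its frequency
    ([invariant_measure_frequency]); cylinders form a pi-system generating the
    Borel sets, so there is at most one such measure.  Conversely, frequencies
    are nonnegative, finitely additive, shift invariant and of total mass one;
    by compactness they are then sigma-additive on the algebra of cylinders, and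
    Caratheodory's theorem extends them to a Borel probability measure
    ([cylinder_extension]), whose invariance can again be tested on cylinders. *)

Set Implicit Arguments.
Unset Strict Implicit.
Unset Printing Implicit Defensive.

Import Order.TTheory GRing.Theory Num.Theory.
Import numFieldNormedType.Exports.

Local Open Scope classical_set_scope.
Local Open Scope ring_scope.

(** * Finite sums and tilings *)

Section FiniteSums.
Variables (R : realType) (T : choiceType).
Implicit Types (A B : set T) (f : T -> R).

Lemma ler_fsum A f f' : finite_set A -> (forall i, A i -> f i <= f' i) ->
  \sum_(i \in A) f i <= \sum_(i \in A) f' i.
Proof.
move=> finA ff'; rewrite !fsbig_finite//= big_seq [leRHS]big_seq.
by apply: ler_sum => i; rewrite in_fset_set// inE => /ff'.
Qed.

Lemma ler_norm_fsum A f : finite_set A ->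
  `|\sum_(i \in A) f i| <= \sum_(i \in A) `|f i|.
Proof. by move=> finA; rewrite !fsbig_finite//= ler_norm_sum. Qed.

Lemma fsum_const A (c : R) : finite_set A ->
  \sum_(i \in A) c = c * (#|` fset_set A|)%fset%:R.
Proof.
move=> finA; rewrite fsbig_finite//= big_const_seq count_predT iter_addr_0.
by rewrite mulr_natr.
Qed.

Lemma fsumB A f f' : finite_set A ->
  \sum_(i \in A) (f i - f' i) = \sum_(i \in A) f i - \sum_(i \in A) f' i.
Proof. by move=> finA; rewrite !fsbig_finite//= sumrB. Qed.

Lemma fsum_subr A f (c : R) : finite_set A ->
  \sum_(i \in A) (f i - c) =
  \sum_(i \in A) f i - c * (#|` fset_set A|)%fset%:R.
Proof. by move=> finA; rewrite fsumB// fsum_const. Qed.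

Lemma fsum_le_const A f (c : R) : finite_set A -> (forall i, A i -> `|f i| <= c) ->
  `|\sum_(i \in A) f i| <= c * (#|` fset_set A|)%fset%:R.
Proof.
move=> finA fc; rewrite (le_trans (ler_norm_fsum _ finA))//.
by rewrite -fsum_const// ler_fsum.
Qed.

(** The terms indexed by the intersection cancel, so a sum of bounded terms
    changes little when its index set changes little. *)
Lemma fsum_setY A B f (M : R) : finite_set A -> finite_set B ->
  (forall i, `|f i| <= M) ->
  `|\sum_(i \in A) f i - \sum_(i \in B) f i| <=
    M * (#|` fset_set (A `+` B)|)%fset%:R.
Proof.
move=> finA finB fM.
rewrite (fsbigID B A)//= (fsbigID A B)//= [B `&` A]setIC opprD addrACA subrr add0r.
have fAB : finite_set (A `&` ~` B) by exact: finite_setIl.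
have fBA : finite_set (B `&` ~` A) by exact: finite_setIl.
have dAB : (A `&` ~` B) `&` (B `&` ~` A) `<=` (fun=> M) @^-1` [set 0].
  by move=> i [[? ?] []].
rewrite -[in leRHS]fsum_const; last by rewrite /setY finite_setU !setDE.
rewrite /setY !setDE (fsbigU fAB fBA dAB)/= !fsum_const//.
by apply: le_trans (ler_normB _ _) _; apply: lerD; apply: fsum_le_const.
Qed.

End FiniteSums.

Section Tiles.
Variables (R : realType) (G : zmodType).
Implicit Types (A B H Z D : set G) (f : G -> R).

Lemma fsum_translate g A f :
  \sum_(h \in translate g A) f h = \sum_(h \in A) f (g + h).
Proof. by apply: fsbig_image => i j _ _; apply: addrI. Qed.

Lemma finite_translate g A : finite_set A -> finite_set (translate g A).
Proof. exact: finite_image. Qed.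

Lemma ncard_translate g A : finite_set A -> ncard (translate g A) = ncard A.
Proof.
by move=> finA; rewrite /ncard fset_set_image// card_imfset//; exact: addrI.
Qed.

Lemma ncard_le A B : finite_set B -> A `<=` B -> (ncard A <= ncard B)%N.
Proof.
move=> finB AB; apply: fsubset_leq_card.
by rewrite -fset_set_sub//; apply: sub_finite_set AB finB.
Qed.

Lemma translate_setY g A B :
  translate g (A `+` B) = translate g A `+` translate g B.
Proof.
apply/seteqP; split=> [_ [a [[Aa nBa]|[Ba nAa]] <-]|].
- by left; split; [exists a|move=> [b Bb /addrI ab]; apply: nBa; rewrite -ab].
- by right; split; [exists a|move=> [b Bb /addrI ab]; apply: nAa; rewrite -ab].
move=> _ [[[a Aa <-] nB]|[[a Ba <-] nA]].
- by exists a => //; left; split=> // Ba; apply: nB; exists a.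
- by exists a => //; right; split=> // Aa; apply: nA; exists a.
Qed.

Lemma translate_comp g h A :
  translate g (translate h A) = translate (g + h) A.
Proof.
apply/seteqP; split=> [_ [_ [a Aa <-] <-]|_ [a Aa <-]].
  by exists a => //; rewrite addrA.
by exists (h + a); [exists a|rewrite addrA].
Qed.

Lemma subgroup0 H : subgroup H -> H 0.
Proof. by case; rewrite inE. Qed.

Lemma subgroupB H a b : subgroup H -> H a -> H b -> H (a - b).
Proof. by case=> _ /(_ a b); rewrite !inE. Qed.

Lemma subgroupN H a : subgroup H -> H a -> H (- a).
Proof.
by move=> sH; rewrite -sub0r; apply: subgroupB => //; exact: subgroup0.
Qed.

Lemma subgroupD H a b : subgroup H -> H a -> H b -> H (a + b).
Proof.
by move=> sH Ha Hb; rewrite -[b]opprK; apply: subgroupB => //; exact: subgroupN.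
Qed.

Lemma coset_decomposition H D h : subgroup H -> fundamental_domain H D ->
  exists2 z, H z & exists2 d, D d & h = z + d.
Proof.
move=> sH fD; have [d [[Dd [z Hz hz]] _]] := fD h.
exists (- z); first exact: subgroupN.
by exists d => //; rewrite -hz addrC addrK.
Qed.

Definition tiles Z D : set G := [set z + d | z in Z & d in D].

Lemma finite_tiles Z D : finite_set Z -> finite_set D -> finite_set (tiles Z D).
Proof. by move=> ? ?; apply: finite_image2. Qed.

(** The decomposition of an element as a sum of an element of [H] and one of a
    fundamental domain of [H] is unique, so the tiles do not overlap. *)
Lemma fsum_tiles H Z D f : subgroup H -> fundamental_domain H D ->
    Z `<=` H -> finite_set Z -> finite_set D ->
  \sum_(h \in tiles Z D) f h = \sum_(z \in Z) \sum_(d \in D) f (z + d).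
Proof.
move=> sH fD ZH finZ finD; rewrite pair_fsbig//.
apply: (reindex_fsbig (fun p : G * G => p.1 + p.2)).
split=> [[z d] [/= Zz Dd]|[z d] [z' d']|h [z Zz [d Dd <-]]].
- by exists z => //; exists d.
- move=> /set_mem[/= Zz Dd] /set_mem[/= Zz' Dd'] /= e.
  have [d0 [_ d0u]] := fD d.
  have dd' : d = d'.
    have dz : d' - d = z - z'.
      by apply/eqP; rewrite subr_eq addrAC e addrAC subrr add0r.
    rewrite -(d0u d) 1?(d0u d')//; split => //.
      exists (d' - d); last by rewrite subrKC.
      by rewrite dz; apply: subgroupB => //; exact: ZH.
    by exists 0; [exact: subgroup0|rewrite addr0].
  by move: e; rewrite dd' => /addIr ->.
- by exists (z, d).
Qed.

End Tiles.

Lemma near_finite_forall (K : choiceType) (A : set K) (P : K -> nat -> Prop) :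
  finite_set A -> (forall k, A k -> \forall n \near \oo, P k n) ->
  \forall n \near \oo, forall k, A k -> P k n.
Proof.
move=> finA AP.
have : \forall n \near \oo, (\bigcap_(k in [set` fset_set A]) P k) n.
  by apply: filter_bigI => k; rewrite in_fset_set// inE => /AP.
rewrite fset_setK//; apply: filterS => n PA k; exact: PA.
Qed.

Lemma fsum_fibers (R : realType) (I J : choiceType) (A : set I) (W : set J)
    (p : I -> J) (g : J -> R) : finite_set A -> finite_set W ->
    (forall i, A i -> W (p i)) ->
  \sum_(i \in A) g (p i) =
  \sum_(j \in W) g j * (#|` fset_set (A `&` [set i | p i = j])|)%fset%:R.
Proof.
move=> finA finW AW.
rewrite [RHS](eq_fsbigr (fun j => \sum_(i \in A) if p i == j then g j else 0)).
  rewrite -exchange_fsbig//; apply: eq_fsbigr => i /set_mem Ai.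
  rewrite (fsbigD1 (p i)) ?eqxx//=; last exact: AW.
  rewrite fsbig1 ?addr0// => j [_ /=]; rewrite eq_sym => /eqP/negbTE.
  by rewrite eq_sym => ->.
move=> j _; rewrite -fsum_const; last exact: finite_setIl.
rewrite fsbig_mkcondr; apply: eq_fsbigr => i _.
congr (if _ then _ else _); apply/idP/eqP => [/set_mem//|?]; exact: mem_set.
Qed.

Lemma card_bigcup_le (R : realType) (I J : choiceType) (K : set J)
    (F : J -> set I) :
  finite_set K -> (forall k, K k -> finite_set (F k)) ->
  (#|` fset_set (\bigcup_(k in K) F k)|)%fset%:R <=
  \sum_(k \in K) ((#|` fset_set (F k)|)%fset%:R : R).
Proof.
move=> finK finF; set A := \bigcup_(_ in _) _.
have finA : finite_set A by exact: bigcup_finite.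
rewrite -[leLHS]mul1r -fsum_const//.
have cardF k : K k ->
    (#|` fset_set (F k)|)%fset%:R =
      \sum_(i \in A) (if i \in F k then 1 else 0 : R) :> R.
  move=> Kk; rewrite -fsbig_mkcondr (_ : A `&` F k = F k).
    by rewrite fsum_const ?mul1r//; exact: finF.
  by apply/seteqP; split=> [i []//|i Fi]; split=> //; exists k.
rewrite (eq_fsbigr (fun k => \sum_(i \in A) (if i \in F k then 1 else 0 : R)))/=;
  last by move=> k /set_mem; exact: cardF.
rewrite exchange_fsbig//; apply: ler_fsum => // i [k Kk Fki].
rewrite (fsbigD1 k)//= mem_set// lerDl.
by apply: fsumr_ge0 => ? _; case: ifP.
Qed.

(** * Averages over aligned and over arbitrary translates of the tiles *)

Section Frequencies.
Variables (R : realType) (G : zmodType) (Gamma D : nat -> set G).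
Hypothesis Gamma_subgroup : forall n, subgroup (Gamma n).
Hypothesis Gamma_decreasing : forall n, Gamma n.+1 `<=` Gamma n.
Hypothesis D_fundamental : forall n, fundamental_domain (Gamma n) (D n).
Hypothesis D_tiling : forall n l, (n < l)%N ->
     D l = \bigcup_(g in D l `&` Gamma n) translate g (D n).
Hypothesis D_folner : folner R D.

Local Notation card A := ((ncard A)%:R : R).

Let finD n : finite_set (D n). Proof. by have [] := D_folner. Qed.
Hint Resolve finD : core.

Let cardD_gt0 n : 0 < card (D n).
Proof.
rewrite ltr0n cardfs_gt0; apply/fset0Pn.
have [_ /(_ n)[d Dd] _] := D_folner.
by exists d; rewrite in_fset_set// inE.
Qed.

Let finite_setY_translate k n : finite_set (translate k (D n) `+` D n).
Proof.
rewrite /setY finite_setU; split; apply: finite_setD => //.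
exact: finite_translate.
Qed.
Hint Resolve finite_setY_translate : core.

Lemma folner_boundary (K : set G) (e : R) : finite_set K -> 0 < e ->
  \forall n \near \oo,
    \sum_(k \in K) card (translate k (D n) `+` D n) <= e * card (D n).
Proof.
move=> finK e0.
have /(near_finite_forall finK) : forall k, K k -> \forall n \near \oo,
    card (translate k (D n) `+` D n) <= e / (1 + card K) * card (D n).
  move=> k _; have [_ _ /(_ k)/cvgrPdist_le/(_ (e / (1 + card K)))] := D_folner.
  have e0' : 0 < e / (1 + card K) by rewrite divr_gt0// ltr_pwDl.
  move=> /(_ e0'); apply: filterS => n; rewrite sub0r normrN ger0_norm ?divr_ge0//.
  by rewrite ler_pdivrMr.
apply: filterS => n Kn.
apply: le_trans (ler_fsum finK Kn) _.
rewrite fsum_const// mulrAC ler_wpM2r// mulrAC ler_pdivrMr ?ltr_pwDl//.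
by rewrite ler_wpM2l ?(ltW e0)// lerDr.
Qed.

Lemma subgroup_le m n : (m <= n)%N -> Gamma n `<=` Gamma m.
Proof.
move=> /subnK <-; elim: (n - m)%N => // k IH.
by rewrite addSn; apply: subset_trans IH.
Qed.

(** Compare [D n + g] with the union of the tiles [z + D s] over the [z] in
    [Gamma s] that lie in [D n + g].  If [h = z + d] with [d] in [D s] lies in
    exactly one of the two sets, then exactly one of [h] and [h - d] lies in
    [D n + g]; for fixed [d] there are few such [h], because [D] is a Folner
    sequence, and [D s] is finite. *)
Lemma unaligned_sum_le s (f : G -> R) (M e : R) :
    (forall h, `|f h| <= M) -> 0 < e ->
    (forall z, Gamma s z -> `|\sum_(d \in D s) f (z + d)| <= e * card (D s)) ->
  \forall n \near \oo, forall g,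
    `|\sum_(h \in D n) f (h + g)| <= 3 * e * card (D n).
Proof.
move=> fM e0 alig.
have M0 : 0 <= M by apply: le_trans (fM 0).
(* The part where the two sets differ, of relative size at most eta, costs
   M * eta <= e; the tiles cover at most (1 + eta) * card (D n) points, and this
   costs 2 * e because eta <= 1. *)
pose eta := Num.min 1 (e / (M + 1)).
have eta0 : 0 < eta by rewrite lt_min ltr01 divr_gt0// ltr_wpDl.
have eta1 : eta <= 1 by rewrite ge_min lexx.
have etaM : M * eta <= e.
  apply: (@le_trans _ _ (M * (e / (M + 1)))).
    by rewrite ler_wpM2l// ge_min lexx orbT.
  by rewrite mulrCA ler_piMr ?(ltW e0)// ler_pdivrMr ?mul1r ?lerDl// ltr_wpDl.
apply: filterS (folner_boundary (finD s) eta0) => n bd g.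
pose E := translate g (D n); pose Z := Gamma s `&` E; pose E' := tiles Z (D s).
have finE : finite_set E by exact: finite_translate.
have finZ : finite_set Z by exact: finite_setIr.
have finE' : finite_set E' by exact: finite_tiles.
have cE : card E = card (D n) by rewrite ncard_translate.
have EE' : card (E `+` E') <= eta * card (D n).
  apply: le_trans bd.
  pose B k := translate g (translate k (D n) `+` D n).
  rewrite [leRHS](eq_fsbigr (fun k => (#|` fset_set (B k)|)%fset%:R)); last first.
    by move=> k _ /=; rewrite -(ncard_translate g).
  apply: le_trans (card_bigcup_le R _ _) => //; last first.
    by move=> k _; apply: finite_translate.
  rewrite ler_nat; apply: ncard_le.
    by apply: bigcup_finite => // k _; apply: finite_translate.
  move=> h EhE'.
  suff [d Dd Hd] : exists2 d, D s d & (translate d E `+` E) h.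
    exists d => //; rewrite /B translate_setY translate_comp [g + d]addrC.
    by rewrite -translate_comp.
  case: EhE' => [[Eh nE'h]|[[z [Gz Ez] [d Dd <-]] nEh]].
    have [z Gz [d Dd hzd]] :=
      coset_decomposition h (Gamma_subgroup s) (D_fundamental s).
    exists d => //; right; split=> // -[a Ea ha]; apply: nE'h.
    exists z; last by exists d.
    split=> //; rewrite (_ : z = a)//.
    by apply/(addrI d); rewrite ha addrC.
  by exists d => //; left; split=> //; exists z => //; rewrite addrC.
have sumE' (f' : G -> R) :
    \sum_(h \in E') f' h = \sum_(z \in Z) \sum_(d \in D s) f' (z + d).
  by apply: (@fsum_tiles _ _ (Gamma s)) => // z [].
have cE' : card Z * card (D s) = card E'.
  rewrite -[RHS]mul1r -[RHS]fsum_const// sumE' (eq_fsbigr (fun=> card (D s))).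
    by rewrite fsum_const// mulrC.
  by move=> z _; rewrite fsum_const// mul1r.
have cE'le : card E' <= 2 * card (D n).
  have /(_ (fun=> 1) 1) := fsum_setY finE' finE (R := R).
  have n1 : forall i : G, `|1 : R| <= 1 by rewrite normr1.
  move=> /(_ n1).
  rewrite !fsum_const// !mul1r setYC -![(#|` _|)%fset]/(ncard _) cE => /ler_normlW.
  have : eta * card (D n) <= card (D n) by rewrite ler_piMl.
  clear n1; move: EE'; lra.
have -> : \sum_(h \in D n) f (h + g) = \sum_(h \in E) f h.
  by rewrite fsum_translate; apply: eq_fsbigr => h _; rewrite addrC.
rewrite -[X in `|X|](subrK (\sum_(h \in E') f h)).
apply: le_trans (ler_normD _ _) _.
have h1 : `|\sum_(h \in E) f h - \sum_(h \in E') f h| <= e * card (D n).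
  apply: le_trans (fsum_setY finE finE' fM) _.
  apply: le_trans (ler_wpM2l M0 EE') _.
  by rewrite mulrA ler_wpM2r.
have h2 : `|\sum_(h \in E') f h| <= e * (2 * card (D n)).
  rewrite sumE'; apply: (@le_trans _ _ (e * card (D s) * card Z)).
    by apply: fsum_le_const => // z [Gz _]; exact: alig.
  by rewrite -mulrA ler_wpM2l ?(ltW e0)// mulrC cE'.
lra.
Qed.

Section Aligned.
Variables (S : finType) (x : full_shift G S).

Definition symbol_at (t : nat) (z : G) : block S (D t) := fun d => x (val d + z).
Arguments symbol_at : clear implicits.

Lemma symbols_symbol_at t z : Gamma t z -> symbols Gamma x (symbol_at t z).
Proof. by move=> Gz; exists z. Qed.

(** Blocks are functions on the finite set [D t] with values in the finite type
    [S]; this is what makes the convergence of [ap], assumed for one symbol at a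
    time, uniform over all symbols. *)
Lemma finite_symbols t : finite_set (@symbols G S Gamma D x t).
Proof.
have -> : @symbols G S Gamma D x t = symbol_at t @` Gamma t.
  apply/seteqP; split=> [B [z Gz Bz]|_ [z Gz <-]]; last exact: symbols_symbol_at.
  by exists z => //; apply/funext => d; rewrite Bz.
pose V : set {ffun fset_set (D t) -> S} := setT.
pose r (v : {ffun fset_set (D t) -> S}) : block S (D t) :=
  fun d => if insub (val d) is Some d' then v d' else x 0.
apply: (@sub_finite_set _ _ (r @` V)); last by apply: finite_image.
move=> _ [z Gz <-]; exists [ffun d => x (val d + z)] => //.
apply/funext => d; rewrite /r insubT => [|dD].
  by rewrite in_fset_set//; case: d.
by rewrite ffunE.
Qed.

Lemma occurrences_symbol_at t s (B : block S (D t)) z : (t < s)%N ->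
  occurrences Gamma B (symbol_at s z) =
  (D s `&` Gamma t) `&` [set g | symbol_at t (g + z) = B].
Proof.
move=> ts; apply/seteqP; split=> g [/= [Dg Gg] HB]; split=> //.
  apply/funext => d; have [e eE <-] := HB d.
  by rewrite /symbol_at addrA -eE.
move=> d; have De : D s (val d + g).
  rewrite (D_tiling ts); exists g => //; exists (val d); last by rewrite addrC.
  by case: d => d /= /set_mem.
exists (SigSub (mem_set De)) => //.
by rewrite -HB /symbol_at /= addrA.
Qed.

Lemma tiles_D t s : (t < s)%N -> tiles (D s `&` Gamma t) (D t) = D s.
Proof.
move=> ts; rewrite [RHS](D_tiling ts); apply/seteqP; split.
  by move=> _ [z Zz [d Dd <-]]; exists z => //; exists d.
by move=> _ [z Zz [d Dd <-]]; exists z => //; exists d.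
Qed.

(** The typical example is the indicator of a cylinder with window [K], read
    along the orbit of [x]. *)
Definition local_observable (K : set G) (f : G -> R) :=
  forall h h', (forall k, K k -> x (k + h) = x (k + h')) -> f h = f h'.

Hypothesis x_ap : forall (t : nat) (B : block S (D t)), symbols Gamma x B ->
     exists nu : R, ap_converges_uniformly Gamma x B nu.

(** The sum of [f] over [z + D t] is, up to boundary terms, a function [N] of
    the symbol of [x] at [z].  Summing over the tiles that make up [z + D s]
    groups the tiles by their symbol [B], and the number of tiles with symbol
    [B] is [ap B C] times the number of tiles, where [C] is the symbol of [x] at
    [z].  The constant is therefore the sum of [nu B * N B] over all [B],
    divided by the size of [D t]. *)
Lemma aligned_sum_near_constant (K : set G) (f : G -> R) (e : R) :
    finite_set K -> local_observable K f -> (forall h, `|f h| <= 1) -> 0 < e ->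
  exists c s, forall z, Gamma s z ->
    `|\sum_(d \in D s) (f (z + d) - c)| <= e * card (D s).
Proof.
move=> finK locf f1 e0.
have e20 : 0 < e / 2 by rewrite divr_gt0.
have [t /= bd] : exists t,
    \sum_(k \in K) card (translate k (D t) `+` D t) <= e / 2 * card (D t).
  have [t _ /(_ t (leqnn t))] := folner_boundary finK e20.
  by exists t.
(* For d in I the whole window K + (z + d) is contained in z + D t, so that
   f (z + d) depends only on the symbol of x at z. *)
pose I := D t `&` [set d | forall k, K k -> D t (k + d)].
have finI : finite_set I by exact: finite_setIl.
have cI : card (D t `\` I) <= e / 2 * card (D t).
  apply: le_trans bd.
  apply: (@le_trans _ _ (\sum_(k \in K) card (D t `&` [set d | ~ D t (k + d)]))).
    apply: le_trans (card_bigcup_le R _ _) => //; last first.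
      by move=> k _; apply: finite_setIl.
    rewrite ler_nat; apply: ncard_le.
      by apply: bigcup_finite => // k _; apply: finite_setIl.
    move=> d [Dd nI].
    have /existsNP[k /not_implyP[Kk nDk]] : ~ forall k, K k -> D t (k + d).
      by move=> H; apply: nI; split.
    by exists k.
  apply: ler_fsum => // k _.
  rewrite -(ncard_translate k); last exact: finite_setIl.
  rewrite ler_nat; apply: ncard_le => //.
  by move=> _ [d [Dd nDk] <-]; left; split=> //; exists d.
pose N z := \sum_(d \in I) f (z + d).
have NE z z' : symbol_at t z = symbol_at t z' -> N z = N z'.
  move=> zz'; apply: eq_fsbigr => d /set_mem[Dd KD].
  apply: locf => k Kk.
  have /(congr1 (fun w : block S (D t) => w (SigSub (mem_set (KD k Kk))))) := zz'.
  by rewrite /symbol_at /= [z + d]addrC [z' + d]addrC !addrA.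
have N1 z : `|N z| <= card (D t).
  apply: le_trans (@fsum_le_const _ _ _ _ 1 finI _) _ => //.
  by rewrite mul1r ler_nat; apply: ncard_le => // d [].
have Nf z : `|\sum_(d \in D t) f (z + d) - N z| <= e / 2 * card (D t).
  have DI : D t `&` I = I by apply/setIidPr => d [].
  rewrite (fsbigID I)//= DI addrAC subrr add0r.
  apply: le_trans cI; rewrite -[leRHS]mul1r; apply: fsum_le_const => //.
  by rewrite -setDE; apply: finite_setD.
pose W := @symbols G S Gamma D x t.
have finW : finite_set W by exact: finite_symbols.
pose rep (B : block S (D t)) := xget 0 [set z | symbol_at t z = B].
have repK z : symbol_at t (rep (symbol_at t z)) = symbol_at t z.
  by apply: (@xgetPex _ 0 [set z' | symbol_at t z' = symbol_at t z]); exists z.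
pose nu (B : block S (D t)) :=
  xget 0 [set r : R | ap_converges_uniformly Gamma x B r].
have nuP B : W B -> ap_converges_uniformly Gamma x B (nu B).
  by move=> /x_ap; apply: xgetPex.
pose w : R := (#|` fset_set W|)%fset%:R.
pose e' := e / 2 / (1 + w).
have w0 : 0 <= w by rewrite ler0n.
have e'0 : 0 < e' by rewrite divr_gt0// ltr_pwDl.
have [s [ts sP]] : exists s, (t < s)%N /\ forall B, W B ->
    forall C, @symbols G S Gamma D x s C -> `|ap Gamma R B C - nu B| <= e'.
  suff : \forall s \near \oo, (t < s)%N /\ forall B, W B ->
      forall C, @symbols G S Gamma D x s C -> `|ap Gamma R B C - nu B| <= e'.
    by case=> s _ /(_ s (leqnn s)); exists s.
  apply: filterI; first by exists t.+1.
  apply: (near_finite_forall (P := fun B s => forall C : block S (D s),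
    symbols Gamma x C -> `|ap Gamma R B C - nu B| <= e') finW) => B WB.
  have [s0 s0P] := nuP B WB e' e'0.
  exists (maxn t s0) => // s /=; rewrite geq_max => /andP[ts s0s] C WC.
  exact/ltW/s0P.
pose c := (\sum_(B \in W) nu B * N (rep B)) / card (D t).
exists c, s => z Gz.
pose Z := D s `&` Gamma t.
have finZ : finite_set Z by exact: finite_setIl.
have sumD (f' : G -> R) :
    \sum_(d \in D s) f' d = \sum_(b \in Z) \sum_(d \in D t) f' (b + d).
  by rewrite -(tiles_D ts); apply: (@fsum_tiles _ _ (Gamma t)) => // b [].
have cD : card (D s) = card Z * card (D t).
  rewrite -[LHS]mul1r -[LHS]fsum_const// sumD (eq_fsbigr (fun=> card (D t))).
    by rewrite fsum_const// mulrC.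
  by move=> b _; rewrite fsum_const// mul1r.
have cD0 : card (D t) != 0 by rewrite gt_eqF.
have cZ0 : card Z != 0.
  by apply/eqP => cZ; have := cardD_gt0 s; rewrite cD cZ mul0r ltxx.
have S2 : \sum_(b \in Z) N (z + b) =
    \sum_(B \in W) N (rep B) * (ap Gamma R B (symbol_at s z) * card Z).
  rewrite (eq_fsbigr (fun b => (N \o rep) (symbol_at t (b + z)))); last first.
    by move=> b _ /=; apply: NE; rewrite repK addrC.
  rewrite (@fsum_fibers _ _ _ Z W (fun b => symbol_at t (b + z)))//; last first.
    move=> b [_ Gb]; apply: symbols_symbol_at; apply: subgroupD => //.
    exact: (subgroup_le (ltnW ts)).
  apply: eq_fsbigr => B _; rewrite /ap occurrences_symbol_at// divfK//.
rewrite fsum_subr// -![(#|` _|)%fset]/(ncard _).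
have -> : c * card (D s) = \sum_(B \in W) N (rep B) * (nu B * card Z).
  rewrite /c cD mulrCA divfK// mulrC mulr_fsuml; apply: eq_fsbigr => B _.
  by rewrite -mulrA mulrCA.
have h1 : `|\sum_(d \in D s) f (z + d) - \sum_(b \in Z) N (z + b)| <=
    e / 2 * card (D s).
  rewrite sumD cD mulrCA mulrC -fsumB//; apply: fsum_le_const => // b _.
  by rewrite (eq_fsbigr (fun d => f (z + b + d))) => // d _; rewrite addrA.
have h2 : `|\sum_(b \in Z) N (z + b) - \sum_(B \in W) N (rep B) * (nu B * card Z)|
    <= e / 2 * card (D s).
  rewrite S2 -fsumB//.
  apply: (@le_trans _ _ (card (D t) * (e' * card Z) * w)).
    apply: fsum_le_const => // B WB.
    rewrite -mulrBr -mulrBl !normrM (ger0_norm (ler0n R (ncard Z))).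
    apply: ler_pM => //; apply: ler_wpM2r => //; apply: sP => //.
    exact: symbols_symbol_at.
  rewrite cD /e' [leLHS](_ : _ = e / 2 * (card Z * card (D t)) * (w / (1 + w))).
    apply: ler_piMr; first by rewrite mulr_ge0 ?(ltW e20)// mulr_ge0.
    by rewrite ler_pdivrMr ?ltr_pwDl// mul1r lerDr.
  by ring.
apply: le_trans (ler_distD (\sum_(b \in Z) N (z + b)) _ _) _.
by rewrite (splitr e) [leRHS]mulrDl lerD.
Qed.

Lemma uniform_frequency (K : set G) (f : G -> R) (e : R) :
    finite_set K -> local_observable K f -> (forall h, `|f h| <= 1) -> 0 < e ->
  exists c, \forall n \near \oo, forall g,
    `|(\sum_(h \in D n) f (h + g)) / card (D n) - c| <= e.
Proof.
move=> finK locf f1 e0; have e30 : 0 < e / 3 by rewrite divr_gt0.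
have [c [s cs]] := aligned_sum_near_constant finK locf f1 e30.
exists c.
have fM h : `|f h - c| <= 1 + `|c|.
  by rewrite (le_trans (ler_normB _ _))// lerD2r.
apply: filterS (unaligned_sum_le fM e30 cs) => n nP g.
rewrite -(ler_pM2r (cardD_gt0 n)) -[X in _ * X <= _]gtr0_norm// -normrM mulrBl.
rewrite divfK ?gt_eqF// -fsum_subr//.
by apply: le_trans (nP g) _; rewrite mulrCA divff// mulr1.
Qed.

End Aligned.

End Frequencies.

(** * Cylinder sets of a subshift *)

Section Cylinders.
Variables (G : zmodType) (S : finType).

Definition agree (K : set G) (y z : full_shift G S) := forall k, K k -> z k = y k.

Lemma nbhs_agree (y : full_shift G S) (K : set G) :
  finite_set K -> nbhs y (agree K y).
Proof.
move=> finK.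
have : \forall z \near y, (\bigcap_(k in [set` fset_set K])
    [set z : full_shift G S | z k = y k]) z.
  apply: filter_bigI => k _.
  apply: (@proj_continuous G (fun=> discrete_topology S) k y [set s | s = y k]).
  by apply: open_nbhs_nbhs; split=> //; exact: discrete_open.
by rewrite fset_setK//; apply: filterS => z.
Qed.

Lemma nbhs_agreeP (y : full_shift G S) (A : set (full_shift G S)) : nbhs y A ->
  exists2 K, finite_set K & agree K y `<=` A.
Proof.
pose F := filter_from (@finite_set G) (fun K => agree K y).
have FF : Filter F.
  apply: filter_from_filter; first by exists set0.
  move=> K L finK finL; exists (K `|` L); first by rewrite finite_setU.
  by move=> z zy; split=> k Kk; apply: zy; [left|right].
suff Fy : F --> y by move=> /Fy[K finK KA]; exists K.
apply/(@cvg_sup _ _ _ F y FF) => h U [V [[W oW WV] Vy] VU].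
exists [set h] => // z zh; apply: VU; rewrite -WV /= in Vy *.
by rewrite /proj zh.
Qed.

Variable x : full_shift G S.
Notation X := (subshift x).

(** These are the clopen sets: finite unions of the cylinders in the narrow
    sense, which prescribe a block on a finite window.  Unlike the latter, they
    form an algebra of sets. *)
Definition cylinder (U : set X) :=
  exists2 K : set G, finite_set K &
    forall y z : X, agree K (val y) (val z) -> U y -> U z.

Lemma agree_sym K y z : agree K y z -> agree K z y.
Proof. by move=> yz k Kk; rewrite yz. Qed.

Lemma sub_agree K L y z : K `<=` L -> agree L y z -> agree K y z.
Proof. by move=> KL yz k /KL; apply: yz. Qed.

Lemma cylinder0 : cylinder set0.
Proof. by exists set0. Qed.

Lemma cylinderC U : cylinder U -> cylinder (~` U).
Proof.
move=> [K finK KU]; exists K => // y z yz nUy Uz; apply: nUy.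
exact: KU (agree_sym yz) Uz.
Qed.

Lemma cylinderU U V : cylinder U -> cylinder V -> cylinder (U `|` V).
Proof.
move=> [K finK KU] [L finL LV]; exists (K `|` L); first by rewrite finite_setU.
move=> y z yz [Uy|Vy].
  by left; apply: KU Uy; apply: sub_agree yz => k; left.
by right; apply: LV Vy; apply: sub_agree yz => k; right.
Qed.

Lemma cylinderT : cylinder setT.
Proof. by exists set0. Qed.

Lemma cylinderI U V : cylinder U -> cylinder V -> cylinder (U `&` V).
Proof.
by move=> cU cV; rewrite -[_ `&` _]setCK setCI;
  apply/cylinderC/cylinderU; exact: cylinderC.
Qed.

Lemma cylinder_bigsetU (F : nat -> set X) n : (forall i, cylinder (F i)) ->
  cylinder (\big[setU/set0]_(i < n) F i).
Proof.
by move=> cF; apply: big_ind => //; [exact: cylinder0|exact: cylinderU].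
Qed.

Lemma val_subshift_act g (y : X) : val (subshift_act g y) = Defs.shift g (val y).
Proof. by []. Qed.

Lemma cylinder_act g U : cylinder U -> cylinder (@subshift_act G S x g @^-1` U).
Proof.
move=> [K finK KU]; exists (translate g K); first exact: finite_translate.
move=> y z yz; apply: KU => k Kk; rewrite !val_subshift_act /Defs.shift.
by apply: yz; exists k => //; rewrite addrC.
Qed.

Lemma nbhs_subshiftP (y : X) (A : set X) : nbhs y A <->
  exists2 K, finite_set K & forall z : X, agree K (val y) (val z) -> A z.
Proof.
split.
  move=> [_ [[W oW <-] /= Wy WA]].
  have [|K finK KW] := @nbhs_agreeP (val y) W; first exact: open_nbhs_nbhs.
  by exists K => // z /KW Wz; apply: WA.
move=> [K finK KA].
have := nbhs_agree (val y) finK; rewrite nbhsE => -[W [oW Wy] WK].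
exists (set_val @^-1` W); split; [by exists W|exact: Wy|].
by move=> z Wz; apply: KA; exact: WK.
Qed.

Lemma cylinder_open U : cylinder U -> open U.
Proof.
move=> [K finK KU]; rewrite openE => y Uy; apply/nbhs_subshiftP.
by exists K => // z yz; exact: KU Uy.
Qed.

(** Exhaust [G] by finite windows; an open set is the union over the windows of
    the points whose restriction to the window forces them into the set. *)
Lemma open_bigcup_cylinder (U : set X) : countable [set: G] -> open U ->
  exists2 F : nat -> set X, (forall i, cylinder (F i)) & U = \bigcup_i F i.
Proof.
move=> /countable_injP[f f_inj] oU.
pose K n := [set k | (f k < n)%N].
have finK n : finite_set (K n).
  rewrite (_ : K n = f @^-1` `I_n)//; apply: finite_preimage => // a b _ _.
  by apply: f_inj; rewrite inE.
exists (fun n => [set y | forall z : X, agree (K n) (val y) (val z) -> U z]).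
  move=> n; exists (K n) => // y z yz yU z' zz'; apply: yU => k Kk.
  by rewrite zz'// yz.
apply/seteqP; split=> [y Uy|y [n _]]; last exact.
have : nbhs y U by apply: open_nbhs_nbhs.
move=> /nbhs_subshiftP[L finL LU].
have [n Ln] : exists n, L `<=` K n.
  have : \forall n \near \oo, forall k, L k -> (f k < n)%N.
    by apply: near_finite_forall => // k _; exists (f k).+1.
  by case=> n _ /(_ n (leqnn n)); exists n.
by exists n => // z yz; apply: LU; exact: sub_agree yz.
Qed.

Lemma compact_subshift : compact [set: X].
Proof.
have cfull : compact [set: full_shift G S].
  have := @tychonoff G (fun=> discrete_topology S) (fun=> setT).
  rewrite (_ : [set f | _] = setT); last by apply/seteqP; split.
  apply=> _; apply: finite_compact; exact: finite_finset.
have cO : compact (orbit_closure x).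
  apply: (subclosed_compact _ cfull) => //; exact: closed_closure.
move=> F PF _.
pose v (y : X) : full_shift G S := val y.
have vFO : F (v @^-1` orbit_closure x).
  by apply: filterS (@filterT _ F _) => y _; exact: set_mem (valP y).
have [z [Oz zF]] := cO (v @ F) _ vFO.
exists (SigSub (mem_set Oz)); split=> // A B FA /nbhs_subshiftP[K finK KB].
have vFA : F (v @^-1` (v @` A)) by apply: filterS FA => a Aa; exists a.
have [_ [[a Aa <-] az]] := zF _ _ vFA (nbhs_agree z finK).
by exists a; split=> //; apply: KB.
Qed.

Lemma cylinder_compact V (F : nat -> set X) :
  cylinder V -> (forall i, cylinder (F i)) ->
  V `<=` \bigcup_i F i -> exists n, V `<=` \big[setU/set0]_(i < n) F i.
Proof.
move=> cV cF VF.
have cptV : compact V.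
  apply: (subclosed_compact _ compact_subshift) => //.
  by rewrite -[V]setCK; apply/open_closedC/cylinder_open/cylinderC.
move: cptV; rewrite compact_cover => /(_ nat setT F).
case=> [i _|//|D _ VD]; first exact: cylinder_open.
exists (\max_(i <- D) i).+1 => y /VD[i Di Fiy].
rewrite -bigcup_mkord; exists i => //=; rewrite ltnS.
exact: (@leq_bigmax_seq _ _ xpredT id).
Qed.

End Cylinders.

(** * Cylinders generate the Borel sigma-algebra *)

Section Borel.
Variables (R : realType) (G : zmodType) (S : finType) (x : full_shift G S).
Hypothesis G_countable : countable [set: G].
Notation X := (subshift x).

Lemma borel_cylinder : <<s @open X >> = <<s @cylinder G S x >>.
Proof.
apply/seteqP; split.
  apply: smallest_sub; first exact: smallest_sigma_algebra.
  move=> U /(open_bigcup_cylinder G_countable)[F cF ->].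
  apply: (@bigcupT_measurable _ (g_sigma_algebraType (@cylinder G S x))) => i.
  exact: sub_sigma_algebra.
apply: smallest_sub; first exact: smallest_sigma_algebra.
by move=> U /cylinder_open; exact: sub_sigma_algebra.
Qed.

Lemma measurable_cylinder (U : set (borel X)) : @cylinder G S x U -> measurable U.
Proof. by move=> /cylinder_open; exact: sub_sigma_algebra. Qed.

Lemma eq_measure_cylinder (P Q : probability (borel X) R) :
  (forall U, @cylinder G S x U -> P U = Q U) ->
  forall A : set (borel X), measurable A -> P A = Q A.
Proof.
move=> PQ; apply: (@measure_unique _ _ (borel X) (@cylinder G S x) (fun=> setT)).
- exact: borel_cylinder.
- by move=> U V; exact: cylinderI.
- by move=> _; exact: cylinderT.
- by apply: bigcup_const; exists 0%N.
- exact: PQ.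
- by move=> _; rewrite -[ltLHS]/(P setT) probability_setT ltry.
Qed.

Lemma measurable_subshift_act g :
  measurable_fun [set: borel X] (@subshift_act G S x g : borel X -> borel X).
Proof.
apply: (@measurability _ _ (borel X) (borel X) _ _ (@cylinder G S x)).
  exact: borel_cylinder.
move=> _ [U cU <-]; rewrite setTI; apply: measurable_cylinder.
exact: cylinder_act.
Qed.

(** The image of [P] under the shift by [g] is a probability measure, to be
    compared with [P] on a generating pi-system. *)
Lemma invariant_cylinder (P : probability (borel X) R) :
  (forall g U, @cylinder G S x U -> P (@subshift_act G S x g @^-1` U) = P U) ->
  invariant_measure (@subshift_act G S x) P.
Proof.
move=> Pinv g A mA.
pose f : {mfun borel X >-> borel X} :=
  mfun_Sub (mem_set (@measurable_subshift_act g)).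
rewrite -[LHS]/(distribution P f A); apply: eq_measure_cylinder mA => U cU.
exact: Pinv.
Qed.

End Borel.

(** * From a finitely additive function on cylinders to a Borel measure *)

Fact cylinder_display : measure_display. Proof. exact: default_measure_display. Qed.

Section Algebra.
Variables (G : zmodType) (S : finType) (x : full_shift G S).

(** A copy of the subshift, so that its cylinders can be declared as its
    measurable sets without interfering with its Borel sets. *)
Definition cylinder_algebra : Type := subshift x.
HB.instance Definition _ := Pointed.on cylinder_algebra.
HB.instance Definition _ := @isAlgebraOfSets.Build
  cylinder_display cylinder_algebra
  (@cylinder G S x) (@cylinder0 G S x) (@cylinderU G S x) (@cylinderC G S x).

End Algebra.

Section Extension.
Variables (R : realType) (G : zmodType) (S : finType) (x : full_shift G S).
Hypothesis G_countable : countable [set: G].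
Notation X := (subshift x).
Variable m : set X -> R.
Hypothesis m_ge0 : forall U, 0 <= m U.
Hypothesis mT : m setT = 1.
Hypothesis mU : forall U V, cylinder U -> cylinder V -> U `&` V = set0 ->
  m (U `|` V) = m U + m V.

Definition content_of (U : set (cylinder_algebra x)) : \bar R := (m U)%:E.

Let m0 : m set0 = 0.
Proof.
have := mU (cylinder0 x) (cylinder0 x) (setI0 _).
by rewrite setU0 -[LHS]addr0 => /addrI <-.
Qed.

Let content_of0 : content_of set0 = 0%E.
Proof. by rewrite /content_of m0. Qed.

Let content_of_ge0 U : (0 <= content_of U)%E.
Proof. by rewrite lee_fin. Qed.

Let content_of_bigsetU (F : nat -> set X) n : (forall i, cylinder (F i)) ->
  trivIset setT F ->
  content_of (\big[setU/set0]_(i < n) F i) =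
  (\sum_(0 <= i < n) content_of (F i))%E.
Proof.
move=> cF tF; elim: n => [|n IH]; first by rewrite big_ord0 big_geq.
rewrite big_ord_recr/= big_nat_recr//= -IH /content_of mU ?EFinD//.
  exact: cylinder_bigsetU.
rewrite -bigcup_mkord; apply/seteqP; split=> // y [[i /= ni Fiy] Fny].
have /trivIsetP/(_ i n Logic.I Logic.I) := tF.
rewrite ltn_eqF// => /(_ isT)/seteqP[+ _].
by move=> /(_ y); apply; split.
Qed.

(** Sigma-additivity is automatic: by compactness, a cylinder that is a
    countable union of cylinders is already the union of finitely many of them,
    so that the partial sums are eventually constant. *)
Let content_of_sigma_additive : semi_sigma_additive content_of.
Proof.
move=> F cF tF cUF.
have [n0 Fn0] := cylinder_compact cUF cF (@subset_refl _ _).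
apply: cvg_near_cst; exists n0 => // n /= n0n.
rewrite -content_of_bigsetU//; congr content_of; apply/seteqP; split.
  by rewrite -bigcup_mkord; apply: bigcup_sub => i _; apply: bigcup_sup.
apply: subset_trans Fn0 _; rewrite -!bigcup_mkord => y [i /= i_n0 Fiy].
by exists i => //=; apply: leq_trans n0n.
Qed.

HB.instance Definition _ := isMeasure.Build _ _ _ content_of
  content_of0 content_of_ge0 content_of_sigma_additive.

Definition borel_extension (A : set (borel X)) : \bar R :=
  measure_extension content_of A.

Lemma borel_extensionE U : cylinder U -> borel_extension U = (m U)%:E.
Proof.
by move=> cU; rewrite /borel_extension /measure_extension measurable_mu_extE.
Qed.

Let borel_extension0 : borel_extension set0 = 0%E.
Proof. by rewrite /borel_extension measure0. Qed.

Let borel_extension_ge0 A : (0 <= borel_extension A)%E.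
Proof. exact: measure_ge0. Qed.

Let borel_extension_sigma_additive : semi_sigma_additive borel_extension.
Proof.
move=> F mF tF mUF.
apply: (@measure_semi_sigma_additive _ _ _ (measure_extension content_of)) => //.
  by move=> i; have := mF i; rewrite /measurable /= borel_cylinder.
by move: mUF; rewrite /measurable /= borel_cylinder.
Qed.

HB.instance Definition _ := isMeasure.Build _ _ _ borel_extension
  borel_extension0 borel_extension_ge0 borel_extension_sigma_additive.

Let borel_extensionT : borel_extension setT = 1%E.
Proof. by rewrite borel_extensionE ?mT//; exact: cylinderT. Qed.

HB.instance Definition _ := Measure_isProbability.Build _ _ _ borel_extension
  borel_extensionT.

Lemma cylinder_extension : exists P : probability (borel X) R,
  forall U, cylinder U -> P U = (m U)%:E.
Proof. by exists borel_extension => U; exact: borel_extensionE. Qed.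

End Extension.

(** * Frequencies of cylinders and unique ergodicity *)

Section Averages.
Variables (R : realType) (G : zmodType) (S : finType) (x : full_shift G S).
Notation X := (subshift x).
Notation act := (@subshift_act G S x).

Definition average (A : set G) (U : set X) (y : X) : R :=
  (\sum_(h \in A) (\1_U (act h y) : R)) / (ncard A)%:R.

Lemma subshift_actD g h y : act (g + h) y = act g (act h y).
Proof. by apply: val_inj; exact: shiftD. Qed.

Lemma indic_le1 U (y : X) : `|\1_U y : R| <= 1.
Proof. by rewrite indicE; case: (_ \in _); rewrite ?normr1 ?normr0. Qed.

Lemma cylinder_indicE (K : set G) U (y z : X) :
  (forall y z : X, agree K (val y) (val z) -> U y -> U z) ->
  agree K (val y) (val z) -> \1_U y = \1_U z :> R.
Proof.
move=> KU yz; rewrite !indicE; congr (nat_of_bool _)%:R.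
apply/idP/idP => /set_mem Uy; apply/mem_set; first exact: KU Uy.
by apply: KU Uy; exact: agree_sym.
Qed.

Lemma subshift_approx (y : X) (K : set G) : finite_set K ->
  exists g, agree K (val y) (val (act g point)).
Proof.
move=> finK; have /= := set_mem (valP y).
by move=> /(_ _ (nbhs_agree (val y) finK))[_ [[g _ <-] yg]]; exists g.
Qed.

(** A cylinder sees only a finite window and [A] is finite, so the orbit of the
    base point [x] approximates [y] well enough. *)
Lemma cylinder_orbit_value (A : set G) (U : set X) (y : X) :
    finite_set A -> cylinder U ->
  exists g, forall h, A h -> \1_U (act h y) = \1_U (act (h + g) point) :> R.
Proof.
move=> finA [K finK KU].
have [g yg] := subshift_approx y (finite_tiles finA finK).
exists g => h Ah; rewrite subshift_actD; apply: cylinder_indicE KU _ => k Kk.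
rewrite !val_subshift_act /Defs.shift; apply: yg.
by exists h => //; exists k => //; rewrite addrC.
Qed.

(** By invariance, [P U] is the integral of the average of [U]. *)
Lemma invariant_le_average (P : probability (borel X) R) (A : set G)
    (U : set X) (c : R) : finite_set A -> (0 < ncard A)%N -> cylinder U ->
    invariant_measure act P ->
    (forall y, average A U y <= c) ->
  (P U <= c%:E)%E.
Proof.
move=> finA A0 cU Pinv avc.
have A0' : 0 < (ncard A)%:R :> R by rewrite ltr0n.
have mA h : measurable (act h @^-1` U : set (borel X)).
  by apply: measurable_cylinder; exact: cylinder_act.
have mf h : measurable_fun [set: borel X]
    (EFin \o (\1_(act h @^-1` U : set (borel X)) : borel X -> R)).
  by apply/measurable_EFinP; exact: measurable_indic.
have mU : measurable (U : set (borel X)) by exact: measurable_cylinder.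
have Pfin : P U \is a fin_num by exact: fin_num_measure.
have E : (\int[P]_y (\sum_(h \in A) (\1_(act h @^-1` U) y : R)%:E) =
    (ncard A)%:R%:E * P U)%E.
  rewrite ge0_integral_fsum//.
  rewrite (eq_fsbigr (fun=> P U)); last first.
    by move=> h _; rewrite integral_indic// setIT; exact: Pinv.
  by rewrite -(fineK Pfin) fsumEFin// fsum_const// -EFinM mulrC.
have : (\int[P]_y (\sum_(h \in A) (\1_(act h @^-1` U) y : R)%:E) <=
    (c * (ncard A)%:R)%:E)%E.
  apply: (@le_trans _ _ (\int[P]_y cst (c * (ncard A)%:R)%:E y)%E).
    apply: ge0_le_integral => //.
    - by move=> y _; rewrite fsumEFin// lee_fin; apply: fsumr_ge0.
    - exact: emeasurable_fsum.
    - move=> y _; rewrite fsumEFin//= lee_fin -ler_pdivrMr//.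
      exact: avc.
  by rewrite integral_cst// -[X in (_ * X)%E]/(P setT) probability_setT mule1.
rewrite E; case: (P U) Pfin => // p _; rewrite -EFinM !lee_fin mulrC.
by rewrite ler_pM2r.
Qed.

End Averages.

Section UniqueErgodicity.
Variables (R : realType) (G : zmodType) (S : finType) (x : full_shift G S).
Hypothesis G_countable : countable [set: G].
Notation X := (subshift x).
Notation act := (@subshift_act G S x).
Variable D : nat -> set G.
Hypothesis finD : forall n, finite_set (D n).
Hypothesis D_neq0 : forall n, (0 < ncard (D n))%N.
Hypothesis orbit_averages : forall (U : set X) (e : R), cylinder U -> 0 < e ->
  exists c, \forall n \near \oo, forall g,
    `|average R (D n) U (act g point) - c| <= e.

Lemma average_near_constant (U : set X) (e : R) : cylinder U -> 0 < e ->
  exists c, \forall n \near \oo, forall y, `|average R (D n) U y - c| <= e.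
Proof.
move=> cU e0; have [c Hc] := orbit_averages cU e0; exists c.
apply: filterS Hc => n Hc y.
have [g yg] := cylinder_orbit_value R y (finD n) cU.
suff -> : average R (D n) U y = average R (D n) U (act g point) by [].
congr (_ / _); apply: eq_fsbigr => h /set_mem Dh.
by rewrite yg// subshift_actD.
Qed.

(** The bound is uniform in [y]; this is what unique ergodicity rests on. *)
Definition is_frequency (U : set X) (r : R) : Prop := 0 <= r /\
  forall e, 0 < e -> \forall n \near \oo, forall y,
    `|average R (D n) U y - r| <= e.

(** The averages at a fixed point are eventually within any [e] of some
    constant, hence form a Cauchy sequence; its limit is close to each of these
    constants, which are independent of the point. *)
Lemma frequency_exists (U : set X) : cylinder U -> exists r, is_frequency U r.
Proof.
move=> cU; pose a n := average R (D n) U point.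
have a_cvg : cvgn a.
  suff aC : cauchy_ex (a @ \oo) by apply: cauchy_cvg; exact: cauchy_exP aC.
  move=> e e0.
  have e20 : 0 < e / 2 by rewrite divr_gt0.
  have [c Hc] := average_near_constant cU e20; exists c.
  apply: filterS Hc => n /(_ point) Hn; rewrite /ball /= distrC.
  by apply: le_lt_trans Hn _; rewrite ltr_pdivrMr// ltr_pMr// ltr1n.
exists (limn a); split.
  apply: limr_ge => //; apply: nearW => n.
  by rewrite divr_ge0//; apply: fsumr_ge0 => h _; rewrite indicE.
move=> e e0; have e20 : 0 < e / 2 by rewrite divr_gt0.
have [c Hc] := average_near_constant cU e20.
have ca : `|limn a - c| <= e / 2.
  have : `|a n - c| @[n --> \oo] --> `|limn a - c|.
    by apply: cvg_norm; apply: cvgB => //; exact: cvg_cst.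
  move=> /cvgr_to_le; apply.
  by apply: filterS Hc => n; exact.
apply: filterS Hc => n Hn y.
rewrite (splitr e); apply: le_trans (ler_distD c _ _) _.
by rewrite lerD// distrC.
Qed.

Definition frequency (U : set X) : R := xget 0 (is_frequency U).

Lemma frequency_ge0 U : 0 <= frequency U.
Proof. by rewrite /frequency; case: xgetP => [r _ []|]. Qed.

Lemma frequencyP U (e : R) : cylinder U -> 0 < e ->
  \forall n \near \oo, forall y, `|average R (D n) U y - frequency U| <= e.
Proof. by move=> /frequency_exists/(xgetPex 0)[_]; apply. Qed.

Lemma frequency_cvg U y : cylinder U ->
  average R (D n) U y @[n --> \oo] --> frequency U.
Proof.
move=> cU; apply/cvgrPdist_le => e /(frequencyP cU).
by apply: filterS => n /(_ y); rewrite distrC.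
Qed.

Lemma frequencyE U y r : cylinder U -> average R (D n) U y @[n --> \oo] --> r ->
  frequency U = r.
Proof.
by move=> cU avr; rewrite -(cvg_lim _ avr)// (cvg_lim _ (frequency_cvg y cU)).
Qed.

Lemma frequencyT : frequency setT = 1.
Proof.
apply: (frequencyE (cylinderT x) (y := point)).
apply: cvg_near_cst; apply: nearW => n.
rewrite /average (eq_fsbigr (fun=> 1)) => [|h _]; last by rewrite indicE in_setT.
by rewrite fsum_const// mul1r divff// pnatr_eq0 -lt0n; exact: D_neq0.
Qed.

Lemma frequencyU U V : cylinder U -> cylinder V -> U `&` V = set0 ->
  frequency (U `|` V) = frequency U + frequency V.
Proof.
move=> cU cV UV.
apply: (frequencyE (cylinderU cU cV) (y := point)).
rewrite (_ : (fun n => _) =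
    (fun n => average R (D n) U point + average R (D n) V point)).
  by apply: cvgD; exact: frequency_cvg.
apply/funext => n; rewrite /average -mulrDl; congr (_ / _).
rewrite !fsbig_finite// -big_split; apply: eq_bigr => h _ /=.
rewrite !indicE in_setU; have : ~ (U (act h point) /\ V (act h point)).
  by move=> UVh; have : (U `&` V) (act h point) by []; rewrite UV.
case: (boolP (_ \in U)) => [/set_mem Uh|_]; last by rewrite add0r.
case: (boolP (_ \in V)) => [/set_mem Vh|_ _]; last by rewrite addr0.
by move=> /(_ (conj Uh Vh)).
Qed.

(** Averaging the translate of [U] at a point is averaging [U] at a translate
    of the point, and the frequency does not depend on the point. *)
Lemma frequency_act g U : cylinder U -> frequency (act g @^-1` U) = frequency U.
Proof.
move=> cU.
apply: (frequencyE (cylinder_act g cU) (y := point)).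
rewrite (_ : (fun n => _) = (fun n => average R (D n) U (act g point))).
  exact: frequency_cvg.
apply/funext => n; congr (_ / _); apply: eq_fsbigr => h _.
by rewrite -[LHS]/(\1_U (act g (act h point))) -!subshift_actD addrC.
Qed.

Lemma invariant_measure_frequency (P : probability (borel X) R) :
  invariant_measure act P ->
  forall U, cylinder U -> P U = (frequency U)%:E.
Proof.
move=> Pinv.
(* The upper bound suffices: for the complement of U it is the lower bound
   for U. *)
have le U : cylinder U -> (P U <= (frequency U)%:E)%E.
  move=> cU; apply/lee_addgt0Pr => e e0.
  have [n _ /(_ n (leqnn n)) nP] := frequencyP cU e0.
  apply: (@invariant_le_average _ _ _ _ P (D n)) => // y.
  by rewrite -lerBlDl; exact: le_trans (ler_norm _) (nP y).
move=> U cU; apply/eqP; rewrite eq_le le//=.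
have mU : measurable (U : set (borel X)) by exact: measurable_cylinder.
have := le _ (cylinderC cU).
have -> : frequency (~` U) = 1 - frequency U.
  rewrite -frequencyT -(setUv U) (frequencyU cU (cylinderC cU) (setICr U)).
  by rewrite addrAC subrr add0r.
rewrite [X in (X <= _)%E](probability_setC P mU).
have : P U \is a fin_num by apply: fin_num_measure.
by case: (P U) => // p _; rewrite -EFinB !lee_fin lerD2l lerN2.
Qed.

Lemma unique_ergodicity : uniquely_ergodic act R.
Proof.
have [P PE] := cylinder_extension G_countable frequency_ge0 frequencyT frequencyU.
exists P; split.
  apply: invariant_cylinder => // g U cU.
  by rewrite !PE//; [rewrite frequency_act|exact: cylinder_act].
move=> Q Qinv; apply: eq_measure_cylinder => // U cU.
by rewrite PE// invariant_measure_frequency.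
Qed.

End UniqueErgodicity.

(** * Strict ergodicity *)

Theorem theoremB (R : realType) (G : zmodType)
  (G_infinite : infinite_set [set: G])
  (G_countable : countable [set: G])
  (G_residually_finite : residually_finite G)
  (Gamma : nat -> set G)
  (Gamma_subgroup : forall n, subgroup (Gamma n))
  (Gamma_finite_index : forall n, finite_index (Gamma n))
  (Gamma_decreasing : forall n, Gamma n.+1 `<=` Gamma n)
  (Gamma_bigcap : \bigcap_n Gamma n = [set 0])
  (D : nat -> set G)
  (D_cover : [set: G] = \bigcup_m D m)
  (D_0 : forall n, D n 0)
  (D_increasing : forall n, D n `<=` D n.+1)
  (D_fundamental : forall n, fundamental_domain (Gamma n) (D n))
  (D_tiling : forall n l, (n < l)%N ->
     D l = \bigcup_(g in D l `&` Gamma n) translate g (D n))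
  (D_folner : folner R D)
  (S : finType) (x : full_shift G S)
  (x_minimal : minimal_system (@subshift_act G S x))
  (x_ap : forall (t : nat) (B : block S (D t)), symbols Gamma x B ->
     exists nu : R, ap_converges_uniformly Gamma x B nu) :
  strictly_ergodic (@subshift_act G S x) R.
Proof.
split=> //.
have [finD _ _] := D_folner.
have D_neq0 n : (0 < ncard (D n))%N.
  by rewrite cardfs_gt0; apply/fset0Pn; exists 0; rewrite in_fset_set// inE.
apply: (unique_ergodicity G_countable finD D_neq0) => U e [K finK KU] e0.
pose f h : R := \1_U (subshift_act h (point : subshift x)).
have locf : local_observable x K f.
  move=> h h' hh'; apply: cylinder_indicE KU _ => k Kk.
  by rewrite !val_subshift_act /Defs.shift; exact/esym/hh'.
have f1 h : `|f h| <= 1 by exact: indic_le1.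
have [c cP] := uniform_frequency Gamma_subgroup Gamma_decreasing D_fundamental
  D_tiling D_folner x_ap finK locf f1 e0.
exists c; apply: filterS cP => n cn g.
rewrite /average (eq_fsbigr (fun h => f (h + g))); first exact: cn.
by move=> h _; rewrite /f subshift_actD.
Qed.
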